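(* Let $\{G_n\}$ be a sequence of finite connected vertex transitive graphs with $|G_n|\to\infty$, such that simple random walk on each $G_n$ is aperiodic, and let $G_n^\diamondsuit=\mathbb{Z}_2\wr G_n$ with the lamplighter walk driven by simple random walk on $G_n$. Then the uniform mixing time has a sharp threshold in the sense that for all $\epsilon>0$, $$\lim_{n\to\infty}\frac{\tau(\epsilon,G_n^\diamondsuit)}{\tau(1/2,G_n^\diamondsuit)}=1.$$
   Context: Graphs have no multiple edges; loops are allowed. $|G|$ is the number of vertices of $G$. For a finite graph $G$ with vertex set $V_G$, the lamplighter graph $G^\diamondsuit=\mathbb{Z}_2\wr G$ has vertices the pairs $(f,x)$ with $f\in\{0,1\}^{V_G}$ and $x\in V_G$. Given the transition probabilities $q(\cdot,\cdot)$ of a random walk on $G$ (here simple random walk), the lamplighter walk on $G^\diamondsuit$ has transition probabilities: for $a\ne b$, $p[(f,a),(h,b)]=q(a,b)/4$ if $f$ and $h$ agree outside $\{a,b\}$; for $a=b$, $p[(f,a),(h,a)]=q(a,a)/2$ if $f$ and $h$ agree outside $\{a\}$; all other transition probabilities are $0$. For a chain on a finite state space $H$ with $t$-step transition probabilities $p^t$ and stationary distribution $\mu$, the $\epsilon$-uniform mixing time is $\tau(\epsilon,H)=\min\{t:|\frac{p^t(x,y)-\mu(y)}{\mu(y)}|\le\epsilon\ \forall x,y\in H\}$; $\tau(\epsilon,G_n^\diamondsuit)$ refers to the lamplighter walk. *)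

(* Defs.v *)
From mathcomp Require Import all_boot all_order perm all_algebra.
From mathcomp Require Import all_classical all_reals all_analysis.
Import Order.TTheory GRing.Theory Num.Theory.
Import numFieldNormedType.Exports.

Set Implicit Arguments.
Unset Strict Implicit.
Unset Printing Implicit Defensive.

Local Open Scope ring_scope.

(* Finite undirected graph without multiple edges; [adj x x] is a loop at x. *)
Record graph := Graph {
  vertex :> finType;
  adj : rel vertex;
  adj_sym : symmetric adj }.

Definition connected_graph (G : graph) : Prop :=
  (0 < #|{: G}|)%N /\ forall x y : G, connect (@adj G) x y.

Definition is_automorphism (G : graph) (s : {perm G}) : Prop :=
  forall x y : G, adj (s x) (s y) = adj x y.

Definition vertex_transitive (G : graph) : Prop :=
  forall x y : G, exists s : {perm G}, is_automorphism s /\ s x = y.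

(* A loop counts once in the degree. *)
Definition degree (G : graph) (x : G) : nat := #|[set y : G | adj x y]|.

Section Chains.
Variables (R : realType) (T : finType).
Implicit Types (P : T -> T -> R) (mu : T -> R).

Fixpoint tstep P (t : nat) (x y : T) : R :=
  if t is s.+1 then \sum_(z : T) P x z * tstep P s z y else (x == y)%:R.

Definition is_stationary P mu : Prop :=
  [/\ forall x, 0 <= mu x, \sum_(x : T) mu x = 1
    & forall y, \sum_(x : T) mu x * P x y = mu y].

Definition return_time P (x : T) (t : nat) : Prop :=
  (0 < t)%N /\ 0 < tstep P t x x.

(* d is the gcd of the return times to x; it is 0 if there are none. *)
Definition is_period P (x : T) (d : nat) : Prop :=
  (forall t, return_time P x t -> (d %| t)%N) /\
  (forall k, (forall t, return_time P x t -> (k %| t)%N) -> (k %| d)%N).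

Definition aperiodic P : Prop := forall x, is_period P x 1.

Definition uniformly_mixed P mu (eps : R) (t : nat) : Prop :=
  forall x y, `|(tstep P t x y - mu y) / mu y| <= eps.

(* The least t with [uniformly_mixed P mu eps t]; 0 if there is no such t, which
   does not happen for an irreducible aperiodic chain and eps > 0. *)
Definition uniform_mixing_time P mu (eps : R) : nat :=
  xget 0%N [set t | uniformly_mixed P mu eps t /\
                    forall s, uniformly_mixed P mu eps s -> (t <= s)%N]%classic.

End Chains.

Definition srw (R : realType) (G : graph) (x y : G) : R :=
  if adj x y then (degree x)%:R^-1 else 0.

(* Vertices of the lamplighter graph: lamp configuration and position. *)
Definition lamp_state (V : finType) : finType := ({ffun V -> bool} * V)%type.

Definition agree_off (V : finType) (A : {set V}) (f h : {ffun V -> bool}) : bool :=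
  [forall z, (z \notin A) ==> (f z == h z)].

Definition lamplighter (R : realType) (V : finType) (q : V -> V -> R)
    (u v : lamp_state V) : R :=
  let: (f, a) := u in
  let: (h, b) := v in
  if a != b then
    if agree_off [set a; b] f h then q a b / 4 else 0
  else
    if agree_off [set a] f h then q a a / 2 else 0.

Definition lamplighter_srw (R : realType) (G : graph) :
    lamp_state G -> lamp_state G -> R :=
  lamplighter (@srw R G).

(* Main.v *)
Require Import Defs.
From mathcomp Require Import all_boot all_order perm all_algebra.
From mathcomp Require Import all_classical all_reals all_analysis.
From mathcomp Require Import ring lra zify.
Import Order.TTheory GRing.Theory Num.Theory.
Import numFieldNormedType.Exports.
Local Open Scope classical_set_scope.
Local Open Scope ring_scope.

(** The lamplighter walk is a symmetric chain on a vertex-transitive graph, so its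
    largest relative deviation from uniformity at an even time [2t > 0] is the one of
    the return probability, which is the sum of [l ^ 2t] over the nontrivial
    eigenvalues [l] of the chain ([density_diag], [density_bound]). Call this sum
    [excess t], and let [rho] be the largest modulus of a nontrivial eigenvalue.
    Since [excess (t + s) <= rho ^ 2s * excess t], the threshold is sharp as soon
    as [rho ^ 2t] tends to 0 when [2t] is the mixing time.

    Multiplicity forces this. The Walsh functions of the lamp configurations split
    the chain into one copy, for each set [A] of vertices, of the simple random
    walk killed on [A] ([walsh_step], [tstep_lamplighter]). By transitivity the
    walks killed at a single vertex all have the same spectral radius, and this
    radius is [rho]. It is attained once for each of the [N] vertices, so that
    [N * rho ^ 2t <= excess t] ([excess_ge]): at the mixing time for the bound
    [b], [rho ^ 2t <= b / N].

    It remains to see why no nontrivial eigenvalue exceeds that radius in modulus.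
    Killing on more vertices only decreases the norm ([killed_norm]). For
    the walk on the graph itself, without its constants, take an eigenfunction
    ([centered_norm]). If some nonzero eigenfunction for the same eigenvalue
    vanishes at a vertex, it is a test function for the walk killed there
    ([vanishing_eigenvalue]). Otherwise symmetry makes its modulus constant, and
    then the eigenvalue is at most [1 - 2 / N] in modulus because the graph is
    connected and not bipartite ([const_norm_eigenvalue]); the walk killed at a
    vertex has at least that radius ([radius_ge]).

    Finally [rho < 1] ([killed_vertex_radius]) gives convergence to the uniform
    distribution, hence the finiteness of the mixing times and the uniqueness of
    the stationary distribution, while [rho >= 1 - 2 / N] makes the mixing times
    tend to infinity, so that bounded rounding errors are negligible. *)

Set Implicit Arguments.
Unset Strict Implicit.
Unset Printing Implicit Defensive.

(** * Symmetric kernels on a finite set *)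

Section Kernels.
Variables (R : realType) (T : finType).
Implicit Types (K : T -> T -> R) (f g : T -> R).

Definition apply K f (x : T) : R := \sum_y K x y * f y.

Definition sqnorm f : R := \sum_x f x ^+ 2.

Definition kernel_sym K : Prop := forall x y, K x y = K y x.

Lemma sqnorm_ge0 f : 0 <= sqnorm f.
Proof. by apply: sumr_ge0 => x _; exact: sqr_ge0. Qed.

Lemma sqnorm_gt0 f x : f x != 0 -> 0 < sqnorm f.
Proof.
move=> fx; rewrite /sqnorm (bigD1 x) //=.
apply: ltr_pwDl; first by rewrite exprn_even_gt0.
by apply: sumr_ge0 => y _; exact: sqr_ge0.
Qed.

Lemma sqnormZ c f : sqnorm (fun x => c * f x) = c ^+ 2 * sqnorm f.
Proof. by rewrite /sqnorm mulr_sumr; apply: eq_bigr => x _; rewrite exprMn. Qed.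

Lemma eq_sqnorm f g : f =1 g -> sqnorm f = sqnorm g.
Proof. by move=> e; apply: eq_bigr => x _; rewrite e. Qed.

Lemma applyD K f g x : apply K (fun y => f y + g y) x = apply K f x + apply K g x.
Proof. by rewrite -big_split; apply: eq_bigr => y _; rewrite mulrDr. Qed.

Lemma applyZ K c f x : apply K (fun y => c * f y) x = c * apply K f x.
Proof. by rewrite mulr_sumr; apply: eq_bigr => y _; rewrite mulrCA. Qed.

Lemma apply_self_adjoint K f g : kernel_sym K ->
  \sum_x f x * apply K g x = \sum_x apply K f x * g x.
Proof.
move=> sK; under eq_bigr do rewrite mulr_sumr.
rewrite exchange_big; apply: eq_bigr => y _ /=.
by rewrite mulr_suml; apply: eq_bigr => x _; rewrite sK mulrCA mulrA.
Qed.

Lemma tstepD K s t x y :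
  tstep K (s + t) x y = \sum_z tstep K s x z * tstep K t z y.
Proof.
elim: s x => [|s IH] x.
  rewrite add0n (bigD1 x) //= eqxx mul1r big1 ?addr0 // => z.
  by rewrite eq_sym => /negbTE ->; rewrite mul0r.
rewrite addSn /=; under eq_bigr do rewrite IH mulr_sumr.
rewrite exchange_big; apply: eq_bigr => z _.
by rewrite mulr_suml; apply: eq_bigr => w _; rewrite mulrA.
Qed.

Lemma tstep1 K x y : tstep K 1 x y = K x y.
Proof.
rewrite /= (bigD1 y) //= eqxx mulr1 big1 ?addr0 // => z /negbTE ->.
by rewrite mulr0.
Qed.

Lemma tstep_sym K t : kernel_sym K -> kernel_sym (tstep K t).
Proof.
move=> sK; elim: t => [|t IH] x y; first by rewrite /= eq_sym.
rewrite -[in RHS]addn1 tstepD; apply: eq_bigr => z _.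
by rewrite tstep1 IH sK mulrC.
Qed.

Lemma tstep_diag K t x : kernel_sym K ->
  tstep K (t + t) x x = sqnorm (fun z => tstep K t z x).
Proof.
move=> sK; rewrite tstepD; apply: eq_bigr => z _.
by rewrite (tstep_sym t sK x) expr2.
Qed.

Lemma tstep_diag_ge0 K t x : kernel_sym K -> 0 <= tstep K (t + t) x x.
Proof. by move=> sK; rewrite tstep_diag //; exact: sqnorm_ge0. Qed.

(** Cauchy-Schwarz for the rows of the [t]-step matrix, with the geometric mean
    of the two diagonal entries weakened to their arithmetic mean. *)
Lemma tstep_offdiag K t x y : kernel_sym K ->
  `|tstep K (t + t) x y| <= (tstep K (t + t) x x + tstep K (t + t) y y) / 2.
Proof.
move=> sK; rewrite !(tstep_diag t _ sK) -big_split mulr_suml tstepD /=.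
apply: le_trans (ler_norm_sum _ _ _) _; apply: ler_sum => z _.
rewrite (tstep_sym t sK x) ler_norml; set a := tstep K t z x.
set b := tstep K t z y.
have h1 := sqr_ge0 (a - b); have h2 := sqr_ge0 (a + b).
by apply/andP; split; nra.
Qed.

(** Each further application of [K] costs a factor [c] in the squared norm of the
    column of [x], and [tstep_diag] reads the diagonal entry as that norm. *)
Lemma tstep_contraction K c t s x : 0 <= c ->
    (forall f, sqnorm (apply K f) <= c * sqnorm f) -> kernel_sym K ->
  tstep K ((t + s) + (t + s)) x x <= c ^+ s * tstep K (t + t) x x.
Proof.
move=> c0 Kc sK; rewrite !tstep_diag //.
elim: s => [|s IH]; first by rewrite addn0 expr0 mul1r.
rewrite addnS exprS -mulrA.
apply: le_trans (Kc (fun z => tstep K (t + s) z x)) _.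
exact: ler_wpM2l.
Qed.

Lemma tstep_eigen K l f t x : (forall y, apply K f y = l * f y) ->
  \sum_y tstep K t x y * f y = l ^+ t * f x.
Proof.
move=> Kf; elim: t x => [|t IH] x.
  rewrite (bigD1 x) //= eqxx expr0 big1 ?addr0 // => y.
  by rewrite eq_sym => /negbTE ->; rewrite mul0r.
under eq_bigr do rewrite /= mulr_suml.
rewrite exchange_big exprSr -mulrA -Kf mulr_sumr; apply: eq_bigr => y _ /=.
by under eq_bigr do rewrite -mulrA; rewrite -mulr_sumr IH; ring.
Qed.

Lemma sqr_sum_le f g : (\sum_x f x * g x) ^+ 2 <= sqnorm f * sqnorm g.
Proof.
have [g0|g0] := eqVneq (sqnorm g) 0.
  rewrite g0 mulr0 (_ : \sum_x _ = 0) ?expr0n // big1 // => x _.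
  apply/eqP; rewrite mulf_eq0; apply/orP; right; apply: contraT => /sqnorm_gt0.
  by rewrite g0 ltxx.
have gp : 0 < sqnorm g by rewrite lt_neqAle eq_sym g0 sqnorm_ge0.
set p := \sum_x _.
have := sqnorm_ge0 (fun x => sqnorm g * f x - p * g x).
rewrite (_ : sqnorm _ = sqnorm g * (sqnorm f * sqnorm g - p ^+ 2)).
  by rewrite pmulr_rge0 // subr_ge0.
set c := sqnorm g; transitivity (\sum_x (c ^+ 2 * f x ^+ 2
    - 2 * c * p * (f x * g x) + p ^+ 2 * g x ^+ 2)).
  by apply: eq_bigr => x _; ring.
rewrite big_split sumrB /= -!mulr_sumr -/p -/(sqnorm f) -/(sqnorm g) -/c; ring.
Qed.

(** The trace of [K ^ 2t] is the squared Hilbert-Schmidt norm of [K ^ t], which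
    dominates the squared operator norm and so [l ^ 2t]. *)
Lemma trace_ge_eigen K l f t x0 : kernel_sym K -> f x0 != 0 ->
    (forall y, apply K f y = l * f y) ->
  l ^+ (t + t) <= \sum_x tstep K (t + t) x x.
Proof.
move=> sK fx0 Kf; rewrite -(ler_pM2r (sqnorm_gt0 fx0)) exprD -expr2 -sqnormZ.
rewrite mulr_suml; apply: ler_sum => x _.
rewrite -(tstep_eigen t x Kf) tstep_diag // (eq_sqnorm (fun z => tstep_sym t sK z x)).
exact: sqr_sum_le.
Qed.

End Kernels.

Section TopEigenvector.
Variables (R : realType) (T : finType) (K : T -> T -> R).
Hypothesis K_sym : kernel_sym K.

Let vec (v : 'rV[R]_#|T|) (x : T) : R := v ord0 (enum_rank x).

Let vec_continuous x : continuous (vec^~ x).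
Proof. exact: coord_continuous. Qed.

Let sum_continuous (F : T -> 'rV[R]_#|T| -> R) :
  (forall x, continuous (F x)) -> continuous (fun v => \sum_x F x v).
Proof.
move=> cF; apply: continuous_big => [|x _]; last exact: cF.
exact: add_continuous.
Qed.

Let sqnorm_continuous (F : T -> 'rV[R]_#|T| -> R) :
  (forall x, continuous (F x)) -> continuous (fun v => sqnorm (F^~ v)).
Proof.
move=> cF; apply: sum_continuous => x v.
exact: (continuous_comp (cF x v) (@exprn_continuous _ 2 _)).
Qed.

(* The unit sphere is compact, and the bound extends to all [g] by scaling. *)
Let max_on_sphere (x0 : T) : exists2 f : T -> R, sqnorm f = 1 &
  forall g : T -> R, sqnorm (apply K g) <= sqnorm (apply K f) * sqnorm g.
Proof.
pose A := [set v : 'rV[R]_#|T| | forall i, `[-1, 1]%classic (v ord0 i)]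
  `&` [set v | sqnorm (vec v) = 1].
pose ofun (g : T -> R) : 'rV[R]_#|T| := \row_i g (enum_val i).
have ofunE g : vec (ofun g) =1 g.
  by move=> x; rewrite /vec /ofun mxE enum_rankK.
have inA v : sqnorm (vec v) = 1 -> A v.
  move=> v1; split=> //= i.
  have : v ord0 i ^+ 2 <= 1.
    rewrite -v1 /sqnorm (bigD1 (enum_val i)) //= /vec enum_valK lerDl.
    by apply: sumr_ge0 => y _; exact: sqr_ge0.
  by rewrite in_itv /= => h; apply/andP; split; nra.
have cA : compact A.
  apply: compact_closedI.
    exact: (@rV_compact R #|T| (fun=> `[-1, 1]%classic)
      (fun=> @segment_compact R (-1) 1)).
  apply: (@preimage_closed _ _ (fun v => sqnorm (vec v)) [set x | x = 1]).
    by move=> v _; apply: sqnorm_continuous => x; exact: vec_continuous.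
  exact: closed_eq.
have A0 : A !=set0.
  exists (ofun (fun x => (x == x0)%:R)); apply: inA.
  rewrite (eq_sqnorm (ofunE _)) /sqnorm (bigD1 x0) //= eqxx big1 ?addr0 ?expr1n //.
  by move=> y /negbTE ->; rewrite expr0n.
have cF : {within A, continuous (fun v => sqnorm (apply K (vec v)))}.
  apply: continuous_subspaceT => v; apply: sqnorm_continuous => x w.
  apply: sum_continuous => y u.
  exact: (continuous_comp (@vec_continuous y u) (@mulrl_continuous _ _ _)).
have [v /set_mem [_ v1] vmax] := EVT_max_rV A0 cA cF.
exists (vec v) => // g.
have [g0|] := eqVneq (sqnorm g) 0.
  rewrite g0 mulr0 le_eqVlt; apply/orP; left; apply/eqP.
  have gz y : g y = 0.
    by apply/eqP; apply: contraT => /sqnorm_gt0; rewrite g0 ltxx.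
  rewrite /sqnorm big1 // => x _.
  by rewrite /apply big1 ?expr0n // => y _; rewrite gz mulr0.
rewrite neq_lt ltNge sqnorm_ge0 /= => gp.
have := vmax (ofun (fun x => (Num.sqrt (sqnorm g))^-1 * g x)).
have sq : (Num.sqrt (sqnorm g))^-1 ^+ 2 = (sqnorm g)^-1.
  by rewrite exprVn sqr_sqrtr // ltW.
rewrite (_ : sqnorm (apply K (vec (ofun _))) = (sqnorm g)^-1 * sqnorm (apply K g)).
  rewrite mulrC ler_pdivrMr //; apply; apply/mem_set/inA.
  by rewrite (eq_sqnorm (ofunE _)) sqnormZ sq mulVf // gt_eqF.
rewrite -sq -sqnormZ; apply: eq_sqnorm => x; rewrite -applyZ.
by apply: eq_bigr => y _; rewrite ofunE.
Qed.

(** A unit vector [f] maximising [sqnorm (apply K f)] satisfies the first-order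
    condition [K (K f) = m f] with [m] the maximum, and factoring
    [K ^ 2 - m] as [(K - l) (K + l)] with [l = sqrt m] turns [f] into an
    eigenvector of [K] itself for [l] or [- l]. *)
Lemma top_eigenvector (x0 : T) : exists l (f : T -> R),
  [/\ exists x, f x != 0, forall x, apply K f x = l * f x
    & forall g, sqnorm (apply K g) <= l ^+ 2 * sqnorm g].
Proof.
have [f f1 fmax] := max_on_sphere x0; set m := sqnorm (apply K f) in fmax.
have m0 : 0 <= m by exact: sqnorm_ge0.
have KKf x : apply K (apply K f) x = m * f x.
  pose h y := m * f y - apply K (apply K f) y.
  have hE : sqnorm h = m * (\sum_y f y * h y) - \sum_y apply K f y * apply K h y.
    rewrite apply_self_adjoint // mulr_sumr -sumrB; apply: eq_bigr => y _.
    by rewrite mulrA -mulrBl expr2.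
  (* Perturbing [f] in the direction [- h] cannot beat the maximum. *)
  pose e := (m + 1)^-1; have e0 : 0 < e by rewrite invr_gt0; lra.
  have em : e * m < 1 by rewrite mulrC ltr_pdivrMr; lra.
  have expand (u w : T -> R) : sqnorm (fun y => u y + - e * w y) =
      sqnorm u - 2 * e * (\sum_y u y * w y) + e ^+ 2 * sqnorm w.
    rewrite /sqnorm !mulr_sumr -sumrB -big_split; apply: eq_bigr => y _ /=; ring.
  have := fmax (fun y => f y + - e * h y).
  have -> : sqnorm (apply K (fun y => f y + - e * h y))
      = sqnorm (fun y => apply K f y + - e * apply K h y).
    by apply: eq_sqnorm => y; rewrite applyD applyZ.
  rewrite !expand f1 -/m => le_m; have Kh0 := sqnorm_ge0 (apply K h).
  have h0 : sqnorm h = 0.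
    have hge := sqnorm_ge0 h.
    have h1 : e * (2 * sqnorm h) <= e * (e * m * sqnorm h).
      by move: le_m; rewrite hE; have := sqr_ge0 e; nra.
    by rewrite ler_pM2l // in h1; nra.
  have hx : h x = 0 by apply/eqP; apply: contraT => /sqnorm_gt0; rewrite h0 ltxx.
  by apply/esym/eqP; rewrite -subr_eq0; apply/eqP.
have f0 : exists x, f x != 0.
  apply/existsP; apply: contraT; rewrite negb_exists => /forallP fz.
  move: f1; rewrite /sqnorm big1 => [/eqP|x _]; first by rewrite eq_sym oner_eq0.
  by move: (fz x); rewrite negbK => /eqP ->; rewrite expr0n.
pose l := Num.sqrt m; have l2 : l ^+ 2 = m by rewrite sqr_sqrtr.
have [/existsP [x gx]|] := boolP [exists x, apply K f x + l * f x != 0].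
  exists l, (fun x => apply K f x + l * f x); split; last by rewrite l2.
    by exists x.
  by move=> y; rewrite applyD applyZ KKf -l2; ring.
rewrite negb_exists => /forallP gz.
exists (- l), f; split=> // [x|]; last by rewrite sqrrN l2.
by have := gz x; rewrite negbK addr_eq0 => /eqP ->; rewrite mulNr.
Qed.

End TopEigenvector.

(** * Killed kernels and simple random walk *)

Section Killing.
Variables (R : realType) (T : finType) (P : T -> T -> R).

Definition killed (A : {set T}) (x y : T) : R :=
  if (x \in A) || (y \in A) then 0 else P x y.

Lemma killed_sym A : kernel_sym P -> kernel_sym (killed A).
Proof. by move=> sP x y; rewrite /killed orbC sP. Qed.

Lemma killed_le (A B : {set T}) x y : (forall x y, 0 <= P x y) -> A \subset B ->
  killed B x y <= killed A x y.
Proof.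
move=> P0 /fintype.subsetP sAB; rewrite /killed.
have [//|/norP[xA yA]] := boolP ((x \in A) || (y \in A)).
  by case/orP => /sAB ->; rewrite ?orbT.
by case: ifP => // _; rewrite P0.
Qed.

End Killing.

Lemma tstep_equivariant (R : realType) (T : finType) (K L : T -> T -> R)
    (s : {perm T}) t x y : (forall x y, L (s x) (s y) = K x y) ->
  tstep L t (s x) (s y) = tstep K t x y.
Proof.
move=> LK; elim: t x => [|t IH] x /=; first by rewrite (inj_eq perm_inj).
rewrite (reindex_perm s) /=; apply: eq_bigr => z _; by rewrite LK IH.
Qed.

Lemma sqnorm_perm (R : realType) (T : finType) (s : {perm T}) (f : T -> R) :
  sqnorm (fun x => f (s x)) = sqnorm f.
Proof. by rewrite /sqnorm [RHS](reindex_perm s). Qed.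

Section SimpleRandomWalk.
Variables (R : realType) (G : graph).
Hypotheses (Gconn : connected_graph G) (Gtrans : vertex_transitive G)
  (Gaper : aperiodic (@srw R G)).

Local Notation P := (@srw R G).
Local Notation N := (#|{: G}|%:R : R).

Lemma order_gt0 : 0 < N.
Proof. by rewrite ltr0n; case: Gconn. Qed.

Lemma degree_const (x y : G) : degree x = degree y.
Proof.
have [s [As <-]] := Gtrans x y.
rewrite /degree -(card_imset _ (@perm_inj _ s)); apply: eq_card => z.
rewrite inE; apply/imsetP/idP => [[w]|az].
  by rewrite inE => aw ->; rewrite As.
by exists (s^-1%g z); rewrite ?permKV // inE -As permKV.
Qed.

Lemma srw_ge0 x y : 0 <= P x y.
Proof. by rewrite /srw; case: ifP => // _; rewrite invr_ge0. Qed.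

Lemma srw_sym : kernel_sym P.
Proof. by move=> x y; rewrite /srw adj_sym (degree_const x y). Qed.

Lemma srw_aut (s : {perm G}) x y : is_automorphism s -> P (s x) (s y) = P x y.
Proof. by move=> As; rewrite /srw As (degree_const (s x) x). Qed.

Lemma killed_aut (s : {perm G}) (A : {set G}) x y : is_automorphism s ->
  killed P (s @: A) (s x) (s y) = killed P A x y.
Proof.
by move=> As; rewrite /killed !mem_imset ?srw_aut //; exact: perm_inj.
Qed.

(** A walk that cannot move has no return times, so 0 divides all of them. *)
Lemma degree_gt0 (x : G) : (0 < degree x)%N.
Proof.
rewrite lt0n; apply/eqP => d0.
have P0 y : P x y = 0 by rewrite /srw d0 invr0 if_same.
have [_ gcd1] := Gaper x.
suff /gcd1 : forall t, return_time P x t -> (0 %| t)%N by [].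
move=> [|t] [] // _; rewrite /= big1 ?ltxx // => z _.
by rewrite P0 mul0r.
Qed.

Lemma srw_sum x : \sum_y P x y = 1.
Proof.
rewrite /srw -big_mkcond /= sumr_const /degree cardsE -[LHS]mulr_natr mulVf //.
by rewrite pnatr_eq0 -lt0n -cardsE; exact: degree_gt0.
Qed.

Lemma srw_adj_ge x y : adj x y -> N^-1 <= P x y.
Proof.
rewrite /srw => ->; rewrite lef_pV2 ?posrE ?ltr0n ?degree_gt0 //.
  by rewrite ler_nat max_card.
by case: Gconn.
Qed.

Lemma const_of_adj (f : G -> R) (c : R) :
  (forall x y, adj x y -> f x = c -> f y = c) ->
  forall x y, f x = c -> f y = c.
Proof.
move=> H x y fx; have cl : fingraph.closed (@adj G) [pred z | f z == c].
  by apply: intro_closed; [exact/sym_connect_sym/adj_sym|move=> u v uv /eqP/(H _ _ uv)/eqP].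
have := closed_connect cl (Gconn.2 x y); rewrite !inE fx eqxx.
by move/esym/eqP.
Qed.

(** Maximum principle: at a vertex where [f] is maximal, so are all its
    neighbours. *)
Lemma subharmonic_const (f : G -> R) :
  (forall x, f x <= apply P f x) -> forall x y, f x = f y.
Proof.
move=> subf x0 y0.
case: (@Order.TotalTheory.arg_maxP _ _ _ x0 xpredT f isT) => m _ mmax.
suff max x y : adj x y -> f x = f m -> f y = f m.
  have E z : f z = f m by exact: const_of_adj max _ _ (erefl (f m)).
  by rewrite !E.
move=> xy fx; apply/eqP; rewrite eq_sym -subr_eq0.
have sum0 : \sum_y P x y * (f m - f y) <= 0.
  under eq_bigr do rewrite mulrBr; rewrite sumrB -mulr_suml srw_sum mul1r.
  by rewrite -fx subr_le0; exact: subf.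
have ge0 z : 0 <= P x z * (f m - f z).
  by rewrite mulr_ge0 ?srw_ge0 // subr_ge0; exact: mmax.
have : P x y * (f m - f y) == 0.
  rewrite eq_le ge0 andbT; apply: le_trans sum0.
  by rewrite (bigD1 y) //= lerDl; apply: sumr_ge0.
rewrite mulf_eq0 => /orP [/eqP Pxy|//].
by have := srw_adj_ge xy; rewrite Pxy leNgt invr_gt0 order_gt0.
Qed.

(** If [f] changed sign along every edge, then [t] steps would multiply it by
    [(-1) ^ t], and all return times would be even. *)
Lemma aperiodic_same_sign (f : G -> R) (x : G) : f x != 0 ->
  ~ (forall y z, adj y z -> f z = - f y).
Proof.
move=> fx alt.
have par t y : tstep P t x y != 0 -> f y = (-1) ^+ t * f x.
  elim: t x {fx} => [|t IH] x /=.
    by rewrite expr0 mul1r pnatr_eq0 eqb0 negbK => /eqP ->.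
  apply: contraNeq => fy; rewrite big1 // => z _.
  have [xz|] := boolP (adj x z); last by rewrite /srw => /negbTE ->; rewrite mul0r.
  apply/eqP; rewrite mulf_eq0; apply/orP; right; apply: contraNT fy.
  by move/IH => ->; rewrite (alt _ _ xz) exprSr; apply/eqP; ring.
have [_ gcd1] := Gaper x.
suff /gcd1 : forall t, return_time P x t -> (2 %| t)%N by [].
move=> t [_ /lt0r_neq0/par fxt]; rewrite dvdn2; apply/negP => odd_t.
move: fxt; rewrite -signr_odd odd_t expr1 mulN1r => /eqP.
by rewrite -subr_eq0 opprK -mulr2n mulrn_eq0 /= (negbTE fx).
Qed.

End SimpleRandomWalk.

(** * The spectral radius of the killed walks *)

Section Comparison.
Variables (R : realType) (T : finType) (K L : T -> T -> R).

Lemma apply_le_abs (f : T -> R) x : (forall y, `|K x y| <= L x y) ->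
  `|apply K f x| <= apply L (fun y => `|f y|) x.
Proof.
move=> KL; apply: le_trans (ler_norm_sum _ _ _) _; apply: ler_sum => y _.
by rewrite normrM ler_wpM2r.
Qed.

Lemma ler_sqnorm (f g : T -> R) : (forall x, `|f x| <= g x) -> sqnorm f <= sqnorm g.
Proof.
move=> fg; apply: ler_sum => x _; rewrite -(real_normK (num_real (f x))).
by rewrite lerXn2r ?nnegrE // (le_trans _ (fg x)).
Qed.

Lemma sqnorm_norm (f : T -> R) : sqnorm (fun x => `|f x|) = sqnorm f.
Proof. by apply: eq_bigr => x _; rewrite real_normK ?num_real. Qed.

End Comparison.

Section Radius.
Variables (R : realType) (G : graph).
Hypotheses (Gconn : connected_graph G) (Gtrans : vertex_transitive G)
  (Gaper : aperiodic (@srw R G)).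

Local Notation P := (@srw R G).
Local Notation N := (#|{: G}|%:R : R).

Lemma apply_killed_aut (s : {perm G}) (A : {set G}) (f : G -> R) x :
    is_automorphism s ->
  apply (killed P (s @: A)) f (s x) = apply (killed P A) (fun y => f (s y)) x.
Proof.
move=> As; rewrite /apply (reindex_perm s); apply: eq_bigr => y _.
by rewrite killed_aut.
Qed.

Lemma killed_ge0 (A : {set G}) x y : 0 <= killed P A x y.
Proof. by rewrite /killed; case: ifP => // _; exact: srw_ge0. Qed.

(** The walk killed at a vertex [v] loses mass, so its top eigenvalue is below 1:
    otherwise the absolute value of a top eigenvector would be subharmonic for
    the original walk, hence constant, although it vanishes at [v]. *)
Lemma killed_vertex_radius : exists rho,
  [/\ 0 <= rho, rho < 1,
      forall v f, sqnorm (apply (killed P [set v]) f) <= rho ^+ 2 * sqnorm f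
    & forall v, exists l f, [/\ `|l| = rho, exists x, f x != 0 &
        forall x, apply (killed P [set v]) f x = l * f x]].
Proof.
have /card_gt0P[v0 _] := Gconn.1.
have sK := killed_sym [set v0] (srw_sym R Gtrans).
have [l [f [[x0 fx0] Kf Kmax]]] := top_eigenvector sK v0.
have abs1 : `|l| < 1.
  rewrite ltNge; apply/negP => l1.
  have subf x : `|f x| <= apply P (fun y => `|f y|) x.
    apply: le_trans (_ : `|l * f x| <= _); first by rewrite normrM ler_peMl.
    rewrite -Kf; apply: apply_le_abs => y; rewrite ger0_norm ?killed_ge0 //.
    by rewrite /killed; case: ifP => // _; exact: srw_ge0.
  have fv0 : f v0 = 0.
    have : l * f v0 = 0.
      by rewrite -Kf /apply big1 // => y _; rewrite /killed !inE eqxx mul0r.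
    move/eqP; rewrite mulf_eq0 => /orP [/eqP l0|/eqP //].
    by move: l1; rewrite l0 normr0 ler10.
  move/eqP: (subharmonic_const Gconn Gaper subf x0 v0).
  by rewrite fv0 normr0 normr_eq0 (negbTE fx0).
exists `|l|; split=> // [v g|v]; have [s [As sv]] := Gtrans v0 v.
  rewrite (real_normK (num_real l)) -sv -imset_set1 -(sqnorm_perm s) -(sqnorm_perm s g).
  by rewrite (eq_sqnorm (fun x => apply_killed_aut _ g x As)).
exists l, (fun x => f (s^-1%g x)); split=> //.
  by exists (s x0); rewrite permK.
move=> x; rewrite -sv -imset_set1 -{1}(permKV s x) apply_killed_aut //.
by rewrite -Kf; apply: eq_bigr => y _; rewrite permK.
Qed.

Section VertexRadius.
Variable rho : R.
Hypotheses (rho0 : 0 <= rho) (vertex_norm : forall v f,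
  sqnorm (apply (killed P [set v]) f) <= rho ^+ 2 * sqnorm f).

(** On absolute values the walk killed on [A] is dominated by the walk killed at
    any one vertex of [A]. *)
Lemma killed_norm (A : {set G}) f : A != finset.set0 ->
  sqnorm (apply (killed P A) f) <= rho ^+ 2 * sqnorm f.
Proof.
case/set0Pn => v vA; rewrite -(sqnorm_norm f).
apply: le_trans (vertex_norm v _); apply: ler_sqnorm => x.
apply: apply_le_abs => y; rewrite ger0_norm ?killed_ge0 //.
by apply: killed_le; [exact: srw_ge0|rewrite finset.sub1set].
Qed.

(** The indicator of the complement of a vertex is a good enough test function:
    at most one unit of mass leaves that complement in one step. *)
Lemma radius_ge : 1 - 2 / N <= rho.
Proof.
have /card_gt0P[v0 _] := Gconn.1.
pose f (x : G) : R := (x != v0)%:R.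
have N0 := order_gt0 R Gconn.
have nf : sqnorm f = N - 1.
  have -> : sqnorm f = \sum_x (1 - (x == v0)%:R).
    by apply: eq_bigr => x _; rewrite /f; case: (x == v0) => /=; ring.
  rewrite sumrB sumr_const -[1 *+ _]/(_%:R); congr (_ - _).
  by rewrite (bigD1 v0) //= eqxx big1 ?addr0 // => x /negbTE ->.
have Qf : \sum_x f x * apply (killed P [set v0]) f x = N - 2 + P v0 v0.
  have E x : f x * apply (killed P [set v0]) f x
      = 1 - P v0 x - (x == v0)%:R * (1 - P v0 v0).
    have [->|xo] := eqVneq x v0; first by rewrite /f eqxx /=; ring.
    rewrite /f xo mul0r subr0 mul1r -[X in X - _](srw_sum Gaper x) (bigD1 v0) //=.
    rewrite (srw_sym R Gtrans v0 x) addrAC subrr add0r /apply (bigD1 v0) //=.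
    rewrite eqxx mulr0 add0r; apply: eq_bigr => y yo.
    by rewrite yo mulr1 /killed !inE (negbTE xo) (negbTE yo).
  under eq_bigr do rewrite E.
  rewrite !sumrB sumr_const (srw_sum Gaper) -[1 *+ _]/(_%:R).
  rewrite (bigD1 v0) //= eqxx big1 ?addr0 => [|x /negbTE ->]; last by rewrite mul0r.
  by rewrite mul1r; ring.
have N1 : 1 <= N by rewrite ler1n; case: Gconn.
have CS := sqr_sum_le f (apply (killed P [set v0]) f); rewrite Qf nf in CS.
have V := vertex_norm v0 f; rewrite nf in V.
have le2 : (N - 2 + P v0 v0) ^+ 2 <= (rho * (N - 1)) ^+ 2.
  apply: le_trans CS _.
  rewrite (_ : _ ^+ 2 = (N - 1) * (rho ^+ 2 * (N - 1))); last by ring.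
  by rewrite ler_wpM2l // subr_ge0.
have : N - 2 + P v0 v0 <= rho * (N - 1).
  have h : 0 <= rho * (N - 1) by apply: mulr_ge0 => //; lra.
  move: le2 h; move: (_ - 2 + _) (rho * _) => a b ab b0.
  by rewrite leNgt; apply/negP => lt; nra.
have Po := srw_ge0 R v0 v0 => le1.
have -> : 1 - 2 / N = (N - 2) / N by field; rewrite gt_eqF.
rewrite ler_pdivrMr //; move: (N) (P v0 v0) rho rho0 Po le1 => n p r r0 p0.
by rewrite mulrBr mulr1; lra.
Qed.

(** An eigenfunction of the walk that vanishes at a vertex is a test function
    for the walk killed there. *)
Lemma vanishing_eigenvalue l f v : (forall x, apply P f x = l * f x) ->
  f v = 0 -> (exists x, f x != 0) -> `|l| <= rho.
Proof.
move=> Pf fv [x fx]; rewrite -(ler_pXn2r (n := 2)) ?nnegrE // real_normK ?num_real //.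
rewrite -(ler_pM2r (sqnorm_gt0 fx)) -sqnormZ -[in leRHS]sqnorm_norm.
apply: le_trans (vertex_norm v _); apply: ler_sqnorm => y.
have [->|yv] := eqVneq y v.
  rewrite fv mulr0 normr0; apply: sumr_ge0 => z _.
  by rewrite mulr_ge0 ?killed_ge0.
rewrite -Pf (_ : apply P f y = apply (killed P [set v]) f y).
  by apply: apply_le_abs => z; rewrite ger0_norm ?killed_ge0.
apply: eq_bigr => z _; rewrite /killed !inE (negbTE yv) /=.
by case: eqP => // ->; rewrite fv !mulr0.
Qed.

(** If the square of an eigenfunction is a nonzero constant, then along some
    edge its sign is kept and along another it changes, and either edge costs
    [2 / N] in the eigenvalue equation. *)
Lemma const_norm_eigenvalue l f : (forall x, apply P f x = l * f x) ->
    (forall x y, f x ^+ 2 = f y ^+ 2) -> (exists x, f x != 0) ->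
    \sum_x f x = 0 ->
  `|l| <= 1 - 2 / N.
Proof.
move=> Pf f2 [x0 fx0] sumf.
have f0 x : f x != 0 by rewrite -sqrf_eq0 (f2 x x0) sqrf_eq0.
have fp x : 0 < f x ^+ 2 by rewrite exprn_even_gt0 //= f0.
have N0 := order_gt0 R Gconn.
(* [e = 1] treats a sign change along the edge, [e = -1] a sign kept. *)
have cost (e : R) x y : e ^+ 2 = 1 -> adj x y -> f y = - e * f x ->
    1 - e * l >= 2 / N.
  move=> e2 xy fy; rewrite -(ler_pM2r (fp x)).
  have -> : (1 - e * l) * f x ^+ 2 = \sum_z P x z * (f x ^+ 2 - e * f x * f z).
    under eq_bigr do rewrite mulrBr.
    rewrite sumrB -mulr_suml srw_sum // mul1r mulrBl mul1r; congr (_ - _).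
    transitivity (e * f x * apply P f x); first by rewrite Pf; ring.
    by rewrite mulr_sumr; apply: eq_bigr => z _; ring.
  have ge0 z : 0 <= P x z * (f x ^+ 2 - e * f x * f z).
    apply: mulr_ge0; first exact: srw_ge0.
    have h : (e * f z) ^+ 2 = f x ^+ 2 by rewrite exprMn e2 mul1r (f2 z x).
    by have := sqr_ge0 (f x - e * f z); nra.
  rewrite (bigD1 y) //= fy.
  have := srw_adj_ge Gconn Gaper xy; have := fp x.
  have : 0 <= \sum_(i | i != y) P x i * (f x ^+ 2 - e * f x * f i).
    exact: sumr_ge0.
  have -> : f x ^+ 2 - e * f x * (- e * f x) = 2 * f x ^+ 2.
    by transitivity (f x ^+ 2 + e ^+ 2 * f x ^+ 2); [ring|rewrite e2; ring].
  by set S := \sum_(_ | _) _; nra.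
have dich x y : f y = f x \/ f y = - f x.
  have /eqP := f2 y x; rewrite eqf_sqr.
  by case/orP => /eqP; [left|right].
rewrite ler_norml; apply/andP; split.
  have [[x [y [xy fy]]]|none] := pselect (exists x y, adj x y /\ f y = f x).
    have := cost (-1) x y _ xy; rewrite opprK mul1r sqrrN expr1n => /(_ erefl fy).
    by lra.
  exfalso; apply: (aperiodic_same_sign Gaper fx0) => y z yz.
  by case: (dich y z) => // fz; case: none; exists y, z.
have [[x [y [xy fy]]]|none] := pselect (exists x y, adj x y /\ f y = - f x).
  have := cost 1 x y _ xy; rewrite expr1n mulN1r => /(_ erefl fy); lra.
have fc x : f x = f x0.
  apply: (@const_of_adj R _ Gconn f (f x0) _ x0 x) => // y z yz fy.
  case: (dich y z) => [->//|fz]; by case: none; exists y, z.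
move: sumf; under eq_bigr do rewrite fc; rewrite sumr_const => /eqP.
by rewrite mulrn_eq0 (negbTE fx0) orbF -(eqr_nat R) gt_eqF.
Qed.

Definition centered (x y : G) : R := P x y - N^-1.

Lemma centered_sym : kernel_sym centered.
Proof. by move=> x y; rewrite /centered srw_sym. Qed.

Lemma sum_centered x : \sum_y centered x y = 0.
Proof.
rewrite sumrB srw_sum // sumr_const -[N^-1 *+ _]mulr_natr mulVf ?subrr //.
by rewrite gt_eqF ?order_gt0.
Qed.

(** Let [f] be a top eigenfunction orthogonal to the constants. Composing it with
    automorphisms gives further eigenfunctions, and a combination of two of them
    vanishes at any prescribed vertex. Either such a combination is nonzero, or
    each composite is a multiple of [f], which forces [f ^ 2] to be constant. *)
Lemma centered_norm f :
  sqnorm (apply centered f) <= rho ^+ 2 * sqnorm f.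
Proof.
have /card_gt0P[v0 _] := Gconn.1.
have [l [g [[x0 gx0] Kg Kmax]]] := top_eigenvector centered_sym v0.
apply: le_trans (Kmax f) _; apply: ler_wpM2r; first exact: sqnorm_ge0.
rewrite -(real_normK (num_real l)) lerXn2r ?nnegrE //.
have [->|l0] := eqVneq l 0; first by rewrite normr0.
have sumg : \sum_x g x = 0.
  suff /eqP : l * \sum_x g x = 0 by rewrite mulf_eq0 (negbTE l0) => /eqP.
  rewrite mulr_sumr; under eq_bigr do rewrite -Kg.
  rewrite exchange_big big1 // => y _ /=; rewrite -mulr_suml.
  by under eq_bigr do rewrite centered_sym; rewrite sum_centered mul0r.
have Pg x : apply P g x = l * g x.
  rewrite -Kg /apply; under [RHS]eq_bigr do rewrite mulrBl.
  by rewrite sumrB -mulr_sumr sumg mulr0 subr0.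
have [[h [v [Ph hv hn]]]|none] := pselect (exists h v,
    [/\ forall x, apply P h x = l * h x, h v = 0 & exists x, h x != 0]).
  exact: vanishing_eigenvalue Ph hv hn.
apply: le_trans radius_ge; apply: (const_norm_eigenvalue Pg _ _ sumg); last by exists x0.
have g0 x : g x != 0.
  by apply/eqP => gx; apply: none; exists g, x; split; [exact: Pg|exact: gx|exists x0].
have prop (s : {perm G}) v w : is_automorphism s ->
    g (s v) * g w = g v * g (s w).
  move=> As; apply/eqP; rewrite eq_sym -subr_eq0; apply: contraT => ne.
  case: none; exists (fun w => g v * g (s w) + - g (s v) * g w), v.
  split; [|by ring|by exists w; rewrite mulNr].
  move=> x; rewrite applyD !applyZ Pg mulrDr; congr (_ + _); last by ring.
  rewrite (_ : apply P (fun y => g (s y)) x = apply P g (s x)).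
    by rewrite Pg; ring.
  rewrite /apply [RHS](reindex_perm s); apply: eq_bigr => y _.
  by rewrite srw_aut.
move=> x y; have [s [As sx]] := Gtrans x y.
have scale z : g (s z) = g y / g x * g z.
  by rewrite -sx mulrAC [_ * g z]prop // mulrAC mulfV ?g0 // mul1r.
have : sqnorm (fun z => g (s z)) = sqnorm g by exact: sqnorm_perm.
rewrite (eq_sqnorm scale) sqnormZ => /eqP.
rewrite -[X in _ == X]mul1r (inj_eq (mulIf _)); last first.
  by rewrite gt_eqF ?(sqnorm_gt0 gx0).
rewrite expr_div_n => /eqP e.
by rewrite -[LHS]mul1r -e divfK // sqrf_eq0.
Qed.

End VertexRadius.
End Radius.

(** * Fourier analysis on the lamp configurations *)

Section Fourier.
Variables (R : realType) (V : finType) (q : V -> V -> R).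
Implicit Types (f h k : {ffun V -> bool}) (A S : {set V}).

Definition walsh A f h : R :=
  \prod_z (if z \in A then (if f z == h z then 1 else - 1) else 1).

Lemma walsh_self A f : walsh A f f = 1.
Proof. by rewrite /walsh big1 // => z _; rewrite eqxx if_same. Qed.

Lemma walsh_set0 f h : walsh finset.set0 f h = 1.
Proof. by rewrite /walsh big1 // => z _; rewrite finset.in_set0. Qed.

Lemma walsh_norm A f h : `|walsh A f h| = 1.
Proof.
rewrite /walsh normr_prod big1 // => z _.
by case: ifP => _; [case: ifP => _|]; rewrite ?normrN normr1.
Qed.

Lemma prod_agree (Q : pred V) f k :
  \prod_(z | Q z) (f z == k z)%:R = [forall z, Q z ==> (f z == k z)]%:R :> R.
Proof.
have [/forallP fk|/forallPn [z]] := boolP [forall z, Q z ==> (f z == k z)].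
  by rewrite big1 // => z Qz; have := fk z; rewrite Qz /= => ->.
rewrite negb_imply => /andP [Qz /negbTE fk].
by rewrite (bigD1 z) //= fk mul0r.
Qed.

Lemma walsh_sum f h : \sum_(A in {set V}) walsh A f h = 2 ^+ #|V| * (f == h)%:R.
Proof.
rewrite -bigA_distr /=.
transitivity (\prod_z (2 * (f z == h z)%:R : R)).
  by apply: eq_bigr => z _; case: (f z == h z) => /=; ring.
rewrite big_split /= prodr_const prod_agree; congr (_ * _%:R); congr nat_of_bool.
apply/forallP/eqP => [fh|-> z]; last by rewrite eqxx.
by apply/ffunP => z; apply/eqP; exact: fh.
Qed.

(** The two lamps at the ends of a step are refreshed and the others kept, so a
    step is a product over the lamps. *)
Lemma lamplighterE f a k b : lamplighter q (f, a) (k, b) =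
  q a b * \prod_z (if z \in [set a; b]%SET then 2^-1 else (f z == k z)%:R).
Proof.
rewrite (bigID (mem [set a; b]%SET)) /=.
rewrite (eq_bigr (fun=> 2^-1 : R)) => [|z ->//]; rewrite prodr_const.
rewrite [X in _ * (_ * X)](eq_bigr (fun z => (f z == k z)%:R)); last first.
  by move=> z /negbTE ->.
rewrite prod_agree -/(agree_off [set a; b]%SET f k) cards2.
have [->|ab] := eqVneq a b; rewrite /= /agree_off.
  rewrite finset.setUid; case: ifP => _ /=; last by rewrite !mulr0.
  by rewrite mulr1 expr1.
case: ifP => _ /=; last by rewrite !mulr0.
by rewrite mulr1; field.
Qed.

(** The Walsh functions diagonalise the lamps: averaging over a refreshed lamp
    of [A] cancels, which kills the walk on [A]. *)
Lemma walsh_step A f a b h :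
  \sum_k lamplighter q (f, a) (k, b) * walsh A k h =
  killed q A a b * walsh A f h.
Proof.
pose w z c : R := (if z \in [set a; b]%SET then 2^-1 else (f z == c)%:R) *
  (if z \in A then (if c == h z then 1 else - 1) else 1).
transitivity (q a b * \sum_(k : {ffun V -> bool}) \prod_z w z (k z)).
  rewrite mulr_sumr; apply: eq_bigr => k _.
  by rewrite lamplighterE big_split /= mulrA.
rewrite -bigA_distr_bigA /=.
have wE z : \sum_c w z c =
    if z \in A then (if z \in [set a; b]%SET then 0
      else if f z == h z then 1 else - 1) else 1.
  rewrite big_bool /w; case: (z \in A); case: (z \in _); case: (f z); case: (h z);
    by rewrite /=; field.
under eq_bigr do rewrite wE.
rewrite /killed; have [|/norP[aA bA]] := boolP (_ || _).
  rewrite mul0r => abA.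
  have [z zA zab] : exists2 z, z \in A & z \in [set a; b]%SET.
    by case/orP: abA; [exists a|exists b]; rewrite // !inE eqxx ?orbT.
  by rewrite (bigD1 z) //= zA zab mul0r mulr0.
congr (_ * _); apply: eq_bigr => z _; case: ifP => // zA.
case: ifP => //; rewrite !inE => /orP [] /eqP za; move: zA.
  by rewrite za (negbTE aA).
by rewrite za (negbTE bA).
Qed.

Lemma sum_lamp_state (F : lamp_state V -> R) :
  \sum_u F u = \sum_c \sum_(k : {ffun V -> bool}) F (k, c).
Proof. by rewrite exchange_big pair_bigA; apply: eq_bigr => -[]. Qed.

(** Fourier inversion on the lamp group: [walsh_step] makes the walk act on the
    coefficient of [A] as the walk killed on [A]. *)
Lemma tstep_lamplighter t f a h b :
  2 ^+ #|V| * tstep (lamplighter q) t (f, a) (h, b) =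
  \sum_(A in {set V}) walsh A f h * tstep (killed q A) t a b.
Proof.
elim: t f a => [|t IH] f a.
  rewrite /= -mulr_suml walsh_sum xpair_eqE -mulrA; congr (_ * _).
  by case: (f == h); case: (a == b) => /=; ring.
rewrite /= sum_lamp_state mulr_sumr.
transitivity (\sum_c \sum_(A in {set V})
    killed q A a c * walsh A f h * tstep (killed q A) t c b).
  apply: eq_bigr => c _; rewrite mulr_sumr.
  under eq_bigr do rewrite mulrCA IH mulr_sumr.
  rewrite exchange_big; apply: eq_bigr => A _ /=.
  rewrite -walsh_step mulr_suml; apply: eq_bigr => k _; by rewrite mulrA.
rewrite exchange_big; apply: eq_bigr => A _ /=.
by rewrite mulr_sumr; apply: eq_bigr => c _; ring.
Qed.

Lemma lamplighter_sum f a : \sum_v lamplighter q (f, a) v = \sum_c q a c.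
Proof.
rewrite sum_lamp_state; apply: eq_bigr => c _.
have <- : killed q finset.set0 a c = q a c by rewrite /killed !finset.in_set0.
rewrite -[RHS]mulr1 -(walsh_set0 f f) -walsh_step; apply: eq_bigr => k _.
by rewrite walsh_set0 mulr1.
Qed.

End Fourier.

(** * Relative deviation from uniformity of the lamplighter walk *)

Section Lamplighter.
Variables (R : realType) (G : graph).
Hypotheses (Gconn : connected_graph G) (Gtrans : vertex_transitive G)
  (Gaper : aperiodic (@srw R G)).

Local Notation P := (@srw R G).
Local Notation N := (#|{: G}|%:R : R).
Local Notation L := (@lamplighter_srw R G).

Definition lamp_states : R := 2 ^+ #|{: G}| * N.

Lemma lamp_states_gt0 : 0 < lamp_states.
Proof. by rewrite mulr_gt0 ?order_gt0 // exprn_gt0. Qed.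

(** The action of the lamplighter walk on the Walsh function of [A]. For the empty
    set this is the walk itself, from which the constants are projected out to
    leave only nontrivial eigenvalues. *)
Definition channel (A : {set G}) : G -> G -> R :=
  if A == finset.set0 then @centered R G else killed P A.

Lemma channel_sym A : kernel_sym (channel A).
Proof.
by rewrite /channel; case: ifP => _; [exact: centered_sym|exact/killed_sym/srw_sym].
Qed.

Lemma channel_aut (s : {perm G}) (A : {set G}) x y : is_automorphism s ->
  channel (s @: A) (s x) (s y) = channel A x y.
Proof.
move=> As; rewrite /channel imset_eq0; case: ifP => _; last exact: killed_aut.
by rewrite /centered srw_aut.
Qed.

Lemma tstep_srw_sum t x : \sum_y tstep P t x y = 1.
Proof.
elim: t x => [|t IH] x.
  by rewrite /= (bigD1 x) //= eqxx big1 ?addr0 // => y; rewrite eq_sym => /negbTE ->.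
rewrite /= exchange_big /= -(srw_sum Gaper x); apply: eq_bigr => y _.
by rewrite -mulr_sumr IH mulr1.
Qed.

(** The constants are an eigenspace of the walk, so subtracting the projection
    onto them commutes with taking powers, except for the power 0. *)
Lemma tstep_centered t x y : tstep (@centered R G) t.+1 x y = tstep P t.+1 x y - N^-1.
Proof.
elim: t x => [|t IH] x; first by rewrite !tstep1.
rewrite -[LHS]/(\sum_z centered R x z * tstep (@centered R G) t.+1 z y).
under eq_bigr do rewrite IH mulrBr.
rewrite sumrB -mulr_suml sum_centered // mul0r subr0.
rewrite /centered; under eq_bigr do rewrite mulrBl.
rewrite sumrB -mulr_sumr; congr (_ - _).
under eq_bigr do rewrite (tstep_sym _ (srw_sym R Gtrans)).
by rewrite tstep_srw_sum mulr1.
Qed.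

(** [lamp_states * tstep L t u v] is the density of the [t]-step distribution with
    respect to the uniform one. *)
Lemma density_expansion t f a h b : (0 < t)%N ->
  lamp_states * tstep L t (f, a) (h, b) - 1 =
  N * \sum_(A in {set G}) walsh R A f h * tstep (channel A) t a b.
Proof.
move=> t0; have N0 := order_gt0 R Gconn.
have E0 : tstep (channel finset.set0) t a b
    = tstep (killed P finset.set0) t a b - N^-1.
  have -> : killed P finset.set0 = P.
    by apply/funext => x; apply/funext => y; rewrite /killed !finset.in_set0.
  by case: t t0 => // t _; rewrite /channel eqxx tstep_centered.
rewrite /lamp_states mulrAC tstep_lamplighter mulrC.
rewrite (bigD1 finset.set0) //= [in RHS](bigD1 finset.set0) //= E0 !walsh_set0.
rewrite [X in _ = _ * (_ + X)](eq_bigr (fun A =>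
  walsh R A f h * tstep (killed P A) t a b)); last first.
  by move=> A /negbTE A0; rewrite /channel A0.
by field; rewrite gt_eqF.
Qed.

(** The sum of [l ^ 2t] over the eigenvalues [l] of all the channels. *)
Definition excess (t : nat) : R :=
  \sum_(A in {set G}) \sum_x tstep (channel A) (t + t) x x.

Lemma diag_excess t x :
  N * \sum_(A in {set G}) tstep (channel A) (t + t) x x = excess t.
Proof.
rewrite /excess exchange_big /=.
rewrite [RHS](eq_bigr (fun=> \sum_(A in {set G}) tstep (channel A) (t + t) x x)).
  by rewrite sumr_const mulrC mulr_natr.
move=> y _; have [s [As <-]] := Gtrans x y.
rewrite (reindex_inj (imset_inj (@perm_inj _ s))) /=.
apply: eq_big => [A|A _]; first by rewrite !inE.
by apply: tstep_equivariant => u v; exact: channel_aut.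
Qed.

Lemma density_diag t u : (0 < t)%N ->
  lamp_states * tstep L (t + t) u u - 1 = excess t.
Proof.
case: u => f x t0; rewrite density_expansion ?addn_gt0 ?t0 //.
rewrite -(diag_excess t x); congr (_ * _).
by apply: eq_bigr => A _; rewrite walsh_self mul1r.
Qed.

(** By transitivity the diagonal of [channel A ^ 2t], summed over [A], is the same
    at every vertex, so the bound of each off-diagonal entry by two diagonal ones
    makes the return probability the largest deviation. *)
Lemma density_bound t u w : (0 < t)%N ->
  `|lamp_states * tstep L (t + t) u w - 1| <= excess t.
Proof.
case: u w => f x [h y] t0; rewrite density_expansion ?addn_gt0 ?t0 //.
have N0 := order_gt0 R Gconn.
rewrite normrM (ger0_norm (ltW N0)).
have -> : excess t = N * \sum_(A in {set G})
    (tstep (channel A) (t + t) x x + tstep (channel A) (t + t) y y) / 2.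
  rewrite -mulr_suml big_split /= mulrA mulrDr !diag_excess; by field.
rewrite ler_pM2l //; apply: le_trans (ler_norm_sum _ _ _) _.
apply: ler_sum => A _; rewrite normrM walsh_norm mul1r.
exact/tstep_offdiag/channel_sym.
Qed.

Lemma excess_contraction rho t s : 
    (forall A f, sqnorm (apply (channel A) f) <= rho ^+ 2 * sqnorm f) ->
  excess (t + s) <= (rho ^+ 2) ^+ s * excess t.
Proof.
move=> norm; rewrite /excess mulr_sumr; apply: ler_sum => A _.
rewrite mulr_sumr; apply: ler_sum => x _.
by apply: tstep_contraction; [exact: sqr_ge0|exact: norm|exact: channel_sym].
Qed.

(** Each of the [N] channels killed at one vertex contributes [rho ^ 2t]. *)
Lemma excess_ge rho t :
    (forall v, exists l f, [/\ `|l| = rho, exists x, f x != 0 &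
        forall x, apply (killed P [set v]) f x = l * f x]) ->
  N * rho ^+ (t + t) <= excess t.
Proof.
move=> eig; have diag0 A : 0 <= \sum_x tstep (channel A) (t + t) x x.
  by apply: sumr_ge0 => x _; exact/tstep_diag_ge0/channel_sym.
rewrite /excess (bigID (mem [set [set v]%SET | v in G]%SET)) /= ler_wpDr //.
  exact: sumr_ge0.
rewrite big_imset /=; last by move=> u v _ _; exact: finset.set1_inj.
rewrite mulrC mulr_natr -sumr_const; apply: ler_sum => v _.
have -> : channel [set v]%SET = killed P [set v]%SET.
  by rewrite /channel -cards_eq0 cards1.
have [l [f [<- [x fx] Kf]]] := eig v.
have -> : `|l| ^+ (t + t) = l ^+ (t + t).
  by rewrite addnn -mul2n !exprM real_normK ?num_real.
apply: trace_ge_eigen fx Kf; exact/killed_sym/srw_sym.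
Qed.

(** The same [rho] controls the decay of [excess] and bounds it from below with a
    factor [N]: these two bounds are what makes the threshold sharp. *)
Lemma excess_profile : exists rho,
  [/\ 0 <= rho, rho < 1, 1 - 2 / N <= rho,
      forall t s, excess (t + s) <= (rho ^+ 2) ^+ s * excess t
    & forall t, N * rho ^+ (t + t) <= excess t].
Proof.
have [rho [rho0 rho1 norm eig]] := killed_vertex_radius Gconn Gtrans Gaper.
exists rho; split=> // [|t s|t]; last exact: excess_ge.
  exact: radius_ge.
apply: excess_contraction => A f; rewrite /channel; case: ifPn => A0.
  exact: centered_norm.
exact: killed_norm.
Qed.

Lemma lamplighter_srw_ge0 u v : 0 <= L u v.
Proof.
case: u v => f a [k b]; rewrite /lamplighter_srw lamplighterE.
rewrite mulr_ge0 ?srw_ge0 //; apply: prodr_ge0 => z _.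
by case: ifP => _; rewrite ?invr_ge0.
Qed.

Lemma lamplighter_srw_sum u : \sum_v L u v = 1.
Proof. by case: u => f a; rewrite lamplighter_sum srw_sum. Qed.

Lemma excess_small e : 0 < e -> exists2 t, (0 < t)%N & excess t <= e.
Proof.
move=> e0; have [rho [rho0 rho1 _ decay lower]] := excess_profile.
have W0 : 0 <= excess 1.
  by apply: le_trans (lower 1%N); rewrite mulr_ge0 ?exprn_ge0.
have r1 : `|rho ^+ 2| < 1 by rewrite ger0_norm ?sqr_ge0 // expr_lt1.
have := cvg_expr r1; move/cvgr0_norm_lt/(_ (e / (excess 1 + 1))).
have eW : 0 < e / (excess 1 + 1) by rewrite divr_gt0 //; lra.
move=> /(_ eW) [s _ /(_ s (leqnn s))] /= small.
exists (1 + s)%N => //; apply: le_trans (decay 1%N s) _.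
move: small; rewrite ger0_norm ?exprn_ge0 ?sqr_ge0 // => /ltW small.
apply: le_trans (ler_wpM2r W0 small) _.
by rewrite mulrAC ler_pdivrMr; [nra|lra].
Qed.

(** A further first step averages the deviations over the starting state. *)
Lemma density_step t e :
    (forall u w, `|lamp_states * tstep L t u w - 1| <= e) ->
  forall u w, `|lamp_states * tstep L t.+1 u w - 1| <= e.
Proof.
move=> dev u w.
have -> : lamp_states * tstep L t.+1 u w - 1
    = \sum_z L u z * (lamp_states * tstep L t z w - 1).
  under eq_bigr do rewrite mulrBr mulr1 mulrCA.
  by rewrite sumrB lamplighter_srw_sum -mulr_sumr.
apply: le_trans (ler_norm_sum _ _ _) _.
rewrite -[e]mul1r -[X in _ <= X * _](lamplighter_srw_sum u) mulr_suml; apply: ler_sum => z _.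
by rewrite normrM ger0_norm ?ler_wpM2l ?lamplighter_srw_ge0 ?dev.
Qed.

(** Every row of the [t]-step matrix tends to the uniform distribution, which is
    therefore the only stationary one. *)
Lemma stationary_uniform mu w : is_stationary L mu -> mu w = lamp_states^-1.
Proof.
move=> [mu0 mu1 muL]; have C0 := lamp_states_gt0.
have muLt t v : \sum_u mu u * tstep L t u v = mu v.
  elim: t v => [|t IH] v.
    rewrite (bigD1 v) //= eqxx mulr1 big1 ?addr0 // => u /negbTE ->.
    by rewrite mulr0.
  under eq_bigr do rewrite mulr_sumr.
  rewrite exchange_big -[RHS]IH; apply: eq_bigr => z _ /=.
  by rewrite -muL mulr_suml; apply: eq_bigr => u _; rewrite mulrA.
have dev e : 0 < e -> `|lamp_states * mu w - 1| <= 0 + e.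
  case/excess_small => t t0 We; rewrite add0r.
  have -> : lamp_states * mu w - 1
      = \sum_u mu u * (lamp_states * tstep L (t + t) u w - 1).
    under eq_bigr do rewrite mulrBr mulr1 mulrCA.
    by rewrite sumrB mu1 -mulr_sumr muLt.
  apply: le_trans (ler_norm_sum _ _ _) _.
  rewrite -[e]mul1r -[X in _ <= X * _]mu1 mulr_suml; apply: ler_sum => u _.
  rewrite normrM ger0_norm // ler_wpM2l //.
  by apply: le_trans We; exact: density_bound.
have : `|lamp_states * mu w - 1| <= 0 by apply/ler_addgt0Pr.
rewrite normr_le0 subr_eq0 => /eqP CM.
by apply: (mulfI (lt0r_neq0 C0)); rewrite CM mulfV ?lt0r_neq0.
Qed.

Lemma uniformly_mixedE mu e t : is_stationary L mu ->
  uniformly_mixed L mu e t <->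
  forall u w, `|lamp_states * tstep L t u w - 1| <= e.
Proof.
move=> st; have C0 := lamp_states_gt0.
split=> H u w; have := H u w; rewrite (stationary_uniform w st) invrK;
  rewrite mulrBl mulVf ?lt0r_neq0 // mulrC //.
Qed.

End Lamplighter.

(** * Mixing times *)

Section MixingTime.
Variables (R : realType) (G : graph).
Hypotheses (Gconn : connected_graph G) (Gtrans : vertex_transitive G)
  (Gaper : aperiodic (@srw R G)).
Variable mu : lamp_state G -> R.
Hypothesis mu_stat : is_stationary (@lamplighter_srw R G) mu.

Local Notation N := (#|{: G}|%:R : R).
Local Notation mixed := (uniformly_mixed (@lamplighter_srw R G) mu).
Local Notation tau := (uniform_mixing_time (@lamplighter_srw R G) mu).

Let mixedE e t : mixed e t <->
  forall u w, `|lamp_states R G * tstep (@lamplighter_srw R G) t u w - 1| <= e.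
Proof. exact: uniformly_mixedE. Qed.

Lemma mixed_leq e s t : (s <= t)%N -> mixed e s -> mixed e t.
Proof.
move=> /subnKC <- ms; elim: (t - s)%N => [|d IH]; first by rewrite addn0.
by rewrite addnS; apply/mixedE/density_step => //; exact/mixedE.
Qed.

Lemma mixed_weaken a b t : a <= b -> mixed a t -> mixed b t.
Proof. by move=> ab ma u w; exact: le_trans (ma u w) ab. Qed.

Lemma mixed_double e t : (0 < t)%N -> mixed e (t + t) <-> excess R G t <= e.
Proof.
move=> t0; split=> [/mixedE m|We].
  have /card_gt0P[v0 _] := Gconn.1.
  rewrite -(density_diag Gconn Gtrans Gaper ([ffun=> true], v0) t0).
  exact: le_trans (ler_norm _) (m _ _).
by apply/mixedE => u w; apply: le_trans We; exact: density_bound.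
Qed.

Lemma mixing_timeP e : 0 < e ->
  mixed e (tau e) /\ forall s, mixed e s -> (tau e <= s)%N.
Proof.
move=> e0; have ex : exists t, `[< mixed e t >].
  have [t t0 We] := excess_small Gconn Gtrans Gaper e0.
  by exists (t + t)%N; apply/asboolP/mixed_double.
have [t /asboolP mt tmin] := ex_minnP ex.
have : exists t, [set t | mixed e t /\ forall s, mixed e s -> (t <= s)%N]%classic t.
  by exists t; split=> // s /asboolP; exact: tmin.
exact: xgetPex.
Qed.

Lemma mixing_time_anti a b : 0 < a -> a <= b -> (tau b <= tau a)%N.
Proof.
move=> a0 ab; have b0 := lt_le_trans a0 ab.
have [ma _] := mixing_timeP a0; have [_ minb] := mixing_timeP b0.
exact/minb/(mixed_weaken ab).
Qed.

(** The mixing time is rounded up to the next even time, which is at least 2. *)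
Lemma excess_mixing_time b : 0 < b -> excess R G (tau b)./2.+1 <= b.
Proof.
move=> b0; have [mb _] := mixing_timeP b0; apply/mixed_double => //.
by apply: mixed_leq mb; lia.
Qed.

(** Since [N] eigenvalues equal to the radius [rho] in absolute value already
    count in the excess at the mixing time [2t], [rho ^ 2t <= b / N]. As [N]
    grows, a fraction [1 / k] of that time still gives a factor [a / b]. *)
Lemma mixing_time_le a b k : 0 < a -> a <= b -> (0 < k)%N ->
  b * (b / a) ^+ k <= N -> (k * tau a <= k.+1 * tau b + 6 * k)%N.
Proof.
move=> a0 ab k0 bigN; have b0 := lt_le_trans a0 ab.
have N0 := order_gt0 R Gconn.
have Wb := excess_mixing_time b0; set t := (tau b)./2.+1 in Wb.
have [rho [rho0 rho1 _ decay lower]] := excess_profile Gconn Gtrans Gaper.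
(* Rounding [t] and [t / k] up is what the term [6 * k] pays for. *)
pose s := (t %/ k).+1.
have ts : (t <= s * k)%N by rewrite /s ltnW // ltn_ceil.
have st : (s * k <= t + k)%N by rewrite /s mulSn addnC leq_add2r leq_divM.
have factor : (rho ^+ 2) ^+ s <= a / b.
  have ab0 : 0 <= a / b by rewrite ltW // divr_gt0.
  rewrite -(ler_pXn2r k0) ?nnegrE ?exprn_ge0 ?sqr_ge0 //.
  rewrite -!exprM; apply: le_trans (_ : rho ^+ (t + t) <= _).
    by apply: ler_wiXn2l => //; [exact: ltW|]; rewrite -mulnA addnn -mul2n leq_mul2l.
  have h1 := le_trans (lower t) Wb.
  have ra : 0 < (b / a) ^+ k by rewrite exprn_gt0 // divr_gt0.
  rewrite -(ler_pM2l N0); apply: le_trans h1 _.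
  have -> : a / b = (b / a)^-1 by rewrite invf_div.
  by rewrite exprVn ler_pdivlMr.
have mixed_a : mixed a ((t + s) + (t + s)).
  apply/mixed_double => //; apply: le_trans (decay t s) _.
  apply: le_trans (ler_wpM2l _ Wb) _; first by rewrite exprn_ge0 ?sqr_ge0.
  by rewrite -ler_pdivlMr.
have [_ /(_ _ mixed_a) mina] := mixing_timeP a0.
have tm : (t + t <= tau b + 2)%N by rewrite /t; clear; lia.
have : (k * tau a <= k * (t + t) + 2 * (s * k))%N.
  by apply: leq_trans (leq_mul (leqnn k) mina) _; clear; lia.
have : (k * (t + t) <= k * (tau b + 2))%N by rewrite leq_mul2l tm orbT.
rewrite mulnDr mulSn; move: (k * tau b)%N (k * tau a)%N (k * (t + t))%N st.
clear; lia.
Qed.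

(** [rho] is at least [1 / 2], so [N * rho ^ 2t <= b] cannot hold before a time of
    order [log N]. *)
Lemma mixing_time_ge b M : 0 < b -> 4 <= N -> b * 4 ^+ M < N -> (M <= tau b)%N.
Proof.
move=> b0 N4 bigN; have Wb := excess_mixing_time b0; set t := (tau b)./2.+1 in Wb.
have [rho [rho0 rho1 rhoN decay lower]] := excess_profile Gconn Gtrans Gaper.
have N0 := order_gt0 R Gconn.
have rho2 : 2^-1 <= rho.
  apply: le_trans rhoN; have : 2 / N <= 2^-1 by rewrite ler_pdivrMr //; lra.
  by lra.
have h1 : N * (4^-1) ^+ t <= b.
  apply: le_trans (le_trans (lower t) Wb); rewrite ler_pM2l //.
  rewrite addnn -mul2n exprM lerXn2r ?nnegrE ?sqr_ge0 ?invr_ge0 //.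
  by have := sqr_ge0 (rho - 2^-1); nra.
have : b * 4 ^+ M < b * 4 ^+ t.
  apply: lt_le_trans bigN _.
  by rewrite -ler_pdivrMr ?exprn_gt0 // -exprVn.
rewrite ltr_pM2l // ltr_eXn2l ?ltr1n // /t; clear; lia.
Qed.

End MixingTime.

Section Threshold.
Variables (R : realType) (G : nat -> graph)
    (mu : forall n, lamp_state (G n) -> R)
    (Gconn : forall n, connected_graph (G n))
    (Gtrans : forall n, vertex_transitive (G n))
    (Gcard : #|{: G n}| @[n --> \oo] --> \oo)
    (Gaper : forall n, aperiodic (@srw R (G n)))
    (mu_stat : forall n, is_stationary (@lamplighter_srw R (G n)) (@mu n)).

Local Notation tau n := (uniform_mixing_time (@lamplighter_srw R (G n)) (@mu n)).

Lemma mixing_time_ratio (a b : R) : 0 < a -> a <= b ->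
  (tau n a)%:R / (tau n b)%:R @[n --> \oo] --> (1 : R).
Proof.
move=> a0 ab; have b0 := lt_le_trans a0 ab.
have big (B : R) : \forall n \near \oo, B <= #|{: G n}|%:R.
  move: Gcard => /cvgrnyP /cvgryPge; exact.
apply/cvgrPdist_le => e e0.
(* The error is at most [1 / k + 6 / tau n b], and [tau n b >= k] eventually. *)
pose k := (Num.truncn (7 / e)).+1.
have ke : 7 / e <= k%:R by apply/ltW/truncnS_gt.
have k0 : 0 < k%:R :> R by rewrite ltr0n.
near=> n.
have le1 : (tau n b <= tau n a)%N by exact: mixing_time_anti.
have ge_k : (k <= tau n b)%N.
  apply: mixing_time_ge => //; first by near: n; exact: big.
  apply: lt_le_trans (_ : b * 4 ^+ k + 1 <= _); first by rewrite ltrDl.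
  by near: n; exact: big.
have le_k : (k * tau n a <= k.+1 * tau n b + 6 * k)%N.
  by apply: mixing_time_le => //; near: n; exact: big.
move: le1 ge_k le_k; move: (tau n a) (tau n b) => x y.
rewrite -!(ler_nat R) natrD !natrM -(natr1 k) => yx ky kxy.
have y0 : 0 < y%:R :> R by exact: lt_le_trans ky.
have d0 : 0 <= x%:R / y%:R - 1 :> R by rewrite subr_ge0 ler_pdivlMr ?mul1r.
rewrite distrC ger0_norm // lerBlDr ler_pdivrMr //.
rewrite -(ler_pM2l k0); apply: le_trans kxy _.
have : 7 <= e * k%:R by rewrite mulrC -ler_pdivrMr.
move: (k%:R : R) k0 ky y0 {ke} => K K0 Ky y0 Ke.
have : 7 * y%:R <= e * K * y%:R by rewrite ler_pM2r.
by nra.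
Unshelve. all: by end_near.
Qed.

End Threshold.

Theorem theorem1p5 (R : realType) (G : nat -> graph)
    (mu : forall n, lamp_state (G n) -> R)
    (Gconn : forall n, connected_graph (G n))
    (Gtrans : forall n, vertex_transitive (G n))
    (Gcard : #|{: G n}| @[n --> \oo] --> \oo)
    (Gaper : forall n, aperiodic (@srw R (G n)))
    (mu_stat : forall n, is_stationary (@lamplighter_srw R (G n)) (mu n)) :
  forall eps : R, 0 < eps ->
    (uniform_mixing_time (@lamplighter_srw R (G n)) (mu n) eps)%:R
      / (uniform_mixing_time (@lamplighter_srw R (G n)) (mu n) (1 / 2))%:R
      @[n --> \oo] --> (1 : R).
Proof.
move=> eps eps0; have half0 : 0 < 1 / 2 :> R by lra.
have [le_half|/ltW ge_half] := leP eps (1 / 2).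
  exact: (mixing_time_ratio Gconn Gtrans Gcard Gaper mu_stat eps0 le_half).
rewrite (_ : (fun n => _) = fun n =>
    ((uniform_mixing_time (@lamplighter_srw R (G n)) (mu n) (1 / 2))%:R
      / (uniform_mixing_time (@lamplighter_srw R (G n)) (mu n) eps)%:R)^-1).
  have := mixing_time_ratio Gconn Gtrans Gcard Gaper mu_stat half0 ge_half.
  by move/(cvgV (oner_neq0 R)); rewrite invr1.
by apply/funext => n; rewrite invf_div.
Qed.
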